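(* Let $S$ be a monoid. Every locally cyclic right $S$-act is hollow; consequently, every cyclic right $S$-act is hollow.
   Context: A right $S$-act over a monoid $S$ is a non-empty set $A$ with an action $A\times S\to A$, $(a,s)\mapsto as$, such that $a1=a$ and $(as)t=a(st)$. A subact of $A$ is a non-empty subset closed under the action; it is proper if it is not equal to $A$. A subact $B$ of $A$ is superfluous in $A$, written $B\leq_s A$, if $B\cup C\neq A$ for every proper subact $C$ of $A$. An $S$-act $A$ is hollow if every proper subact of $A$ is superfluous in $A$. An $S$-act $A$ is cyclic if $A=aS$ for some $a\in A$, and locally cyclic if for all $a,a'\in A$ there exists $a''\in A$ such that $a,a'\in a''S$. *)

(* Defs.v *)
From HB Require Import structures.
From mathcomp Require Import all_boot monoid.
From mathcomp Require Import boolp classical_sets.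

Set Implicit Arguments.
Unset Strict Implicit.
Unset Printing Implicit Defensive.

Local Open Scope group_scope.
Local Open Scope classical_set_scope.

HB.mixin Record isRightAct (S : monoidType) (A : Type) := {
  ract : A -> S -> A;
  ract_nonempty : [set: A] !=set0;
  ract1 : forall a : A, ract a 1 = a;
  ractM : forall (a : A) (s t : S), ract a (s * t) = ract (ract a s) t
}.

#[short(type="rightActType")]
HB.structure Definition RightAct (S : monoidType) := {A of isRightAct S A}.

Section Acts.
Variables (S : monoidType) (A : rightActType S).
Implicit Types (B C : set A) (a : A).

Definition subact B : Prop :=
  B !=set0 /\ forall (b : A) (s : S), B b -> B (ract b s).

Definition proper_subact B : Prop := subact B /\ B <> [set: A].

Definition superfluous B : Prop :=
  subact B /\ forall C, proper_subact C -> B `|` C <> [set: A].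

Definition principal a : set A := [set ract a s | s in [set: S]].

End Acts.

Definition hollow (S : monoidType) (A : rightActType S) : Prop :=
  forall B : set A, proper_subact B -> superfluous B.

Definition cyclic_act (S : monoidType) (A : rightActType S) : Prop :=
  exists a : A, [set: A] = principal a.

Definition locally_cyclic (S : monoidType) (A : rightActType S) : Prop :=
  forall a a' : A, exists a'' : A, principal a'' a /\ principal a'' a'.

(* Main.v *)
(* If B and C are proper subacts, pick a outside B and c outside C; a common
   generator of a and c lies in neither B nor C, so B and C do not cover A. *)
Require Import Defs.
From HB Require Import structures.
From mathcomp Require Import all_boot monoid.
From mathcomp Require Import boolp classical_sets.

(** A subact absorbs all that its elements generate ([subact_principal]), so a common generator of a
    point missed by [B] and a point missed by [C] is itself missed by both. The cyclic case reduces
    to this through [cyclic_locally_cyclic]. *)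

Lemma subact_principal (S : monoidType) (A : rightActType S) (B : set A) (a : A) :
  subact B -> B a -> subset (principal a) B.
Proof. by move=> [_ BS] Ba _ [s _ <-]; exact: BS. Qed.

Lemma proper_subact_notin (S : monoidType) (A : rightActType S) (B : set A) :
  proper_subact B -> exists a, ~ B a.
Proof.
move=> [_ BnT]; apply/existsNP => BT; apply: BnT.
by apply/seteqP; split=> // x _; exact: BT.
Qed.

Lemma locally_cyclic_hollow (S : monoidType) (A : rightActType S) :
  locally_cyclic A -> hollow A.
Proof.
move=> lcA B pB; split; first exact: pB.1.
move=> C pC BCT.
have [a nBa] := proper_subact_notin _ _ _ pB.
have [c nCc] := proper_subact_notin _ _ _ pC.
have [d [da dc]] := lcA a c.
(* Whichever of [B], [C] contains [d] also contains the point chosen outside it. *)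
have : setU B C d by rewrite BCT.
case=> [Bd|Cd].
- exact/nBa/(subact_principal _ _ _ _ pB.1 Bd).
- exact/nCc/(subact_principal _ _ _ _ pC.1 Cd).
Qed.

(** A generator of the whole act serves as [a''] for every pair. *)
Lemma cyclic_locally_cyclic (S : monoidType) (A : rightActType S) :
  cyclic_act A -> locally_cyclic A.
Proof. by move=> [g gA] a a'; exists g; rewrite -gA. Qed.

Theorem proposition3p3 (S : monoidType) :
  (forall A : rightActType S, locally_cyclic A -> hollow A) /\
  (forall A : rightActType S, cyclic_act A -> hollow A).
Proof.
split=> A; first exact: locally_cyclic_hollow.
by move/cyclic_locally_cyclic; exact: locally_cyclic_hollow.
Qed.
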